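(* Let $\mathcal{D}$ be a quad-graph with an edge labelling $\alpha:E(\mathcal{D})\to\mathbb{C}$. A 3D consistent system $Q(f,f_1,f_{12},f_2;\alpha_1,\alpha_2)=0$ on $\mathcal{D}$ admits a zero curvature representation with spectral parameter dependent $2\times2$ matrices: there exist matrices attached to directed edges of $\mathcal{D}$, $$L(\mathfrak{e},\alpha(\mathfrak{e});\lambda):\vec{E}(\mathcal{D})\to \mathrm{GL}_2(\mathbb{C})[\lambda],$$ such that for any quadrilateral face $(f,f_1,f_{12},f_2)\in F(\mathcal{D})$ there holds $$L(f_{12},f_1,\alpha_2;\lambda)L(f_1,f,\alpha_1;\lambda)=L(f_{12},f_2,\alpha_1;\lambda)L(f_2,f,\alpha_2;\lambda),$$ identically in $\lambda$.
   Context: A quad-graph $\mathcal{D}$ is a strongly regular polytopal cell decomposition of a surface with all faces quadrilateral; $V(\mathcal{D})$, $E(\mathcal{D})$, $\vec{E}(\mathcal{D})$, $F(\mathcal{D})$ are its vertices, edges, directed edges and faces. A labelling $\alpha:E(\mathcal{D})\to\mathbb{C}$ is a function taking equal values on opposite edges of each face. Vertices and the values at them of a solution $f$ of the system are denoted by the same letter; $L(f_i,f,\alpha_i;\lambda)$ is the matrix attached to the edge directed from $f$ to $f_i$, which carries the label $\alpha_i$. $\mathrm{GL}_2(\mathbb{C})[\lambda]$ denotes $2\times 2$ invertible matrices depending polynomially on the spectral parameter $\lambda$. $Q(x,u,y,v;\alpha,\beta)$ is a polynomial of degree 1 in each of $x,u,y,v$ (coefficients depending on $\alpha,\beta$), with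 the symmetry $Q(x,u,y,v;\alpha,\beta)=\varepsilon Q(x,v,y,u;\beta,\alpha)=\sigma Q(u,y,v,x;\beta,\alpha)$, $\varepsilon,\sigma\in\{\pm1\}$, and it is required that $Q=0$ be uniquely solvable for any one of the four fields given the other three. $f:V(\mathcal{D})\to\mathbb{C}$ is a solution if for every face with cyclically ordered vertices $f,f_1,f_{12},f_2$, where $(f,f_1),(f_2,f_{12})$ carry the label $\alpha_1$ and $(f,f_2),(f_1,f_{12})$ carry $\alpha_2$, one has $Q(f,f_1,f_{12},f_2;\alpha_1,\alpha_2)=0$. 3D consistency: the equation can be consistently imposed on all faces of a combinatorial cube whose edges parallel to the $i$-th direction all carry the parameter $\alpha_i$. That is, given initial values $f,f_1,f_2,f_3$, define $f_{ij}$ ($i\neq j$) by $Q(f,f_i,f_{ij},f_j;\alpha_i,\alpha_j)=0$; then the three equations $Q(f_i,f_{ij},f_{123},f_{ik};\alpha_j,\alpha_k)=0$ (one for each $i\in\{1,2,3\}$, with $\{i,j,k\}=\{1,2,3\}$) for $f_{123}$ lead to identical results. *)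

(* Defs.v *)
From HB Require Import structures.
From Stdlib Require Import Relations.
From mathcomp Require Import all_boot all_order all_algebra.
From mathcomp Require Import classical_sets cardinality reals.
From mathcomp Require Export complex mpoly.

Set Implicit Arguments.
Unset Strict Implicit.
Unset Printing Implicit Defensive.

Import GRing.Theory.
Local Open Scope ring_scope.

(* Strong regularity (closed cells are embedded, and two of them meet in the
   empty set or in one closed cell) makes every cell determined by its set of
   vertices, so the cell decomposition is recorded by the relation
   "a, b, c, d are, in this cyclic order, the vertices of a face". *)
Definition is_edge (V : Type) (face : V -> V -> V -> V -> Prop) (a b : V) :=
  exists c d, face a b c d.

(* Compactness, connectedness, orientability and emptiness of the boundary are
   not required. *)
Record quadGraph := QuadGraph {
  vertex :> Type;
  face : vertex -> vertex -> vertex -> vertex -> Prop;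
  face_rot : forall a b c d, face a b c d -> face b c d a;
  face_refl : forall a b c d, face a b c d -> face a d c b;
  face_embedded : forall a b c d, face a b c d -> a <> b /\ a <> c;
  (* Two distinct faces share at most one edge or one vertex: a pair of opposite
     vertices of a face is not opposite in another face ... *)
  face_diag : forall a b c d b' d', face a b c d -> face a b' c d' ->
    (b' = b /\ d' = d) \/ (b' = d /\ d' = b);
  (* ... and is not an edge. *)
  diag_not_edge : forall a b c d, face a b c d -> ~ is_edge face a c;
  (* Surface: an edge lies on one or two faces, and the link of each vertex is
     a finite connected graph; with the previous axioms it is therefore a cycle
     (interior vertex) or a path (boundary vertex). *)
  edge_faces : forall a b c1 d1 c2 d2 c3 d3,
    face a b c1 d1 -> face a b c2 d2 -> face a b c3 d3 ->
    [\/ (c1, d1) = (c2, d2), (c1, d1) = (c3, d3) | (c2, d2) = (c3, d3)];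
  star_nonempty : forall v, exists w, is_edge face v w;
  star_finite : forall v, finite_set [set w | is_edge face v w]%classic;
  link_connected : forall v u w, is_edge face v u -> is_edge face v w ->
    clos_refl_trans vertex (fun u w => exists d, face v u d w) u w
}.

Definition edge (D : quadGraph) : D -> D -> Prop := is_edge (@face D).

(* A function on undirected edges is a symmetric function of their endpoints;
   its values on non-adjacent pairs are irrelevant.  The second pair of opposite
   sides of a face is covered by [face_rot]. *)
Definition labelling (C : Type) (D : quadGraph) (al : D -> D -> C) :=
  (forall a b, edge a b -> al a b = al b a) /\
  (forall a b c d, face a b c d -> al a b = al d c).

Section Equation.
Variable C : comNzRingType.

(* Q al be is the polynomial Q(x,u,y,v; al, be), the variables 'X_0, 'X_1, 'X_2,
   'X_3 being x, u, y, v. *)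
Variable Q : C -> C -> {mpoly C[4]}.

Definition Qval (x u y v al be : C) : C :=
  (Q al be).@[tnth [tuple x; u; y; v]].

Definition degree_one_in_each :=
  forall al be (i : 'I_4), \max_(m <- msupp (Q al be)) m i = 1%N.

Definition D4_symmetric :=
  exists eps sigma : C,
    [/\ eps = 1 \/ eps = -1,
        sigma = 1 \/ sigma = -1,
        forall x u y v al be,
          Qval x u y v al be = eps * Qval x v y u be al
      & forall x u y v al be,
          Qval x u y v al be = sigma * Qval u y v x be al].

(* Unique solvability is meant for generic values of the other three fields,
   i.e. off the zero locus of some nonzero polynomial: for *all* values it would
   force Q to be a multiple of x + y + s (u + v) + e with s = 1 or s = -1. *)
Definition uniquely_solvable :=
  forall al be (i : 'I_4), exists2 g : {mpoly C[4]}, g != 0 &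
    forall p : 'I_4 -> C, g.@[p] != 0 ->
      exists! z : C, (Q al be).@[fun j => if j == i then z else p j] = 0.

(* y is the value defined by x, u, v through Q(x,u,y,v; al, be) = 0 *)
Definition defines (x u v al be y : C) :=
  unique (fun z => Qval x u z v al be = 0) y.

(* Any two of the three equations that define f123 define the same value. *)
Definition consistent3D :=
  forall al1 al2 al3 f f1 f2 f3 f12 f13 f23 : C,
    defines f f1 f2 al1 al2 f12 ->
    defines f f1 f3 al1 al3 f13 ->
    defines f f2 f3 al2 al3 f23 ->
  [/\ forall y z, defines f1 f12 f13 al2 al3 y ->
                  defines f2 f12 f23 al1 al3 z -> y = z,
      forall y z, defines f1 f12 f13 al2 al3 y ->
                  defines f3 f13 f23 al1 al2 z -> y = z
    & forall y z, defines f2 f12 f23 al1 al3 y ->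
                  defines f3 f13 f23 al1 al2 z -> y = z].

Definition solution (D : quadGraph) (al : D -> D -> C) (f : D -> C) :=
  forall a b c d : D, face a b c d ->
    Qval (f a) (f b) (f c) (f d) (al a b) (al a d) = 0.

(* M f1 f al la is the matrix of the Moebius map f3 |-> f13 given by
   Q(f,f1,f13,f3; al, la) = 0, i.e.
     f13 = (M 0 0 * f3 + M 0 1) / (M 1 0 * f3 + M 1 1). *)
Definition transfer (M : C -> C -> C -> C -> 'M[C]_2) :=
  forall f f1 al la f3 f13, Qval f f1 f13 f3 al la =
    (M f1 f al la 1 0 * f3 + M f1 f al la 1 1) * f13 -
    (M f1 f al la 0 0 * f3 + M f1 f al la 0 1).

End Equation.

(* Main.v *)
(* Since Q has degree one in each field, Q(f,f1,f13,f3; al1,la) = 0 gives f13 as a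
   Moebius function of f3, with matrix M(f1,f,al1;la).  3D consistency, with la as
   the parameter of the third direction, says that the two ways of transporting
   f3 around a face agree for all but finitely many f3, so the two matrix
   products define the same Moebius map and are proportional. *)
Require Import Defs.
From mathcomp Require Import all_boot all_order all_algebra.
From mathcomp Require Import reals.
From mathcomp Require Import complex mpoly.
From mathcomp Require Import ring.

Set Implicit Arguments.
Unset Strict Implicit.
Unset Printing Implicit Defensive.

Import GRing.Theory.
Local Open Scope ring_scope.

(** In characteristic zero the images of the naturals below [size p] are distinct roots, one more
    than the degree allows. *)
Lemma poly_eq0_eval (F : numDomainType) (p : {poly F}) :
  (forall x, p.[x] = 0) -> p = 0.
Proof.
move=> p0; apply: (@roots_geq_poly_eq0 _ _ [seq n%:R | n <- iota 0 (size p)]).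
- by apply/allP => x _; apply/rootP.
- by rewrite map_inj_uniq ?iota_uniq //; apply: Num.Theory.mulrIn; rewrite oner_eq0.
- by rewrite size_map size_iota.
Qed.

(** Each monomial contains the [i]-th variable to the power 0 or 1, so it is affine in [x]. *)
Lemma meval_affine (C : comNzRingType) (n : nat) (p : {mpoly C[n]}) (i : 'I_n)
    (v : C -> 'I_n -> C) :
  (forall m, m \in msupp p -> (m i <= 1)%N) ->
  (forall x j, v x j = if j == i then x else v 0 j) ->
  forall x, p.@[v x] = p.@[v 0] + x * (p.@[v 1] - p.@[v 0]).
Proof.
move=> deg_p v_upd x; rewrite !mevalE -sumrB mulr_sumr -big_split.
apply: eq_big_seq => m /deg_p deg_m /=.
have split_i y : \prod_j v y j ^+ m j = y ^+ m i * \prod_(j | j != i) v 0 j ^+ m j.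
  rewrite (bigD1 i) //= v_upd eqxx; congr (_ * _).
  by apply: eq_bigr => j /negbTE ji; rewrite v_upd ji.
rewrite !split_i; case: (m i) deg_m => [|[|//]] _; rewrite ?expr0 ?expr1; ring.
Qed.

Section Moebius.
Variable F : numFieldType.
Implicit Types (A B : 'M[F]_2) (x : F).

Definition mnum A x := A 0 0 * x + A 0 1.
Definition mden A x := A 1 0 * x + A 1 1.
Definition moebius A x := mnum A x / mden A x.
Definition mdenp A : {poly F} := (A 1 0)%:P * 'X + (A 1 1)%:P.

Lemma matrix2P A B : A 0 0 = B 0 0 -> A 0 1 = B 0 1 -> A 1 0 = B 1 0 ->
  A 1 1 = B 1 1 -> A = B.
Proof.
have ord2 (i : 'I_2) : i = 0 \/ i = 1.
  by case: i => -[|[|//]] ?; [left | right]; apply: val_inj.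
by move=> e00 e01 e10 e11; apply/matrixP => i j; case: (ord2 i) (ord2 j) => -> [] ->.
Qed.

Lemma mulmx2E A B i j : (A *m B) i j = A i 0 * B 0 j + A i 1 * B 1 j.
Proof.
rewrite mxE !big_ord_recl big_ord0 addr0.
by congr (A _ _ * B _ _ + A _ _ * B _ _); apply: val_inj.
Qed.

Lemma det2E A : \det A = A 0 0 * A 1 1 - A 0 1 * A 1 0.
Proof.
rewrite (expand_det_row _ 0) !big_ord_recl big_ord0 /cofactor !det_mx11 !mxE /=.
rewrite expr0 expr1 mul1r mulN1r addr0 mulrN.
by congr (A _ _ * A _ _ - A _ _ * A _ _); apply: val_inj.
Qed.

Lemma horner_mdenp A x : (mdenp A).[x] = mden A x.
Proof. by rewrite !hornerE. Qed.

Lemma mdenp_neq0 A : \det A != 0 -> mdenp A != 0.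
Proof.
apply: contraNneq => A0; have := horner_mdenp A 1; have := horner_mdenp A 0.
rewrite A0 !horner0 /mden mulr0 add0r mulr1 => A11 A10.
by rewrite det2E -A11 mulr0 add0r -[A 1 0]addr0 [X in _ + X]A11 -A10 mulr0 oppr0.
Qed.

Lemma mnum_mulmx A B x : mden B x != 0 ->
  mnum A (moebius B x) = mnum (A *m B) x / mden B x.
Proof.
by rewrite /moebius /mnum !mulmx2E /mden => ?; field.
Qed.

Lemma mden_mulmx A B x : mden B x != 0 ->
  mden A (moebius B x) = mden (A *m B) x / mden B x.
Proof.
by rewrite /moebius /mnum /mden !mulmx2E => ?; field.
Qed.

(** The common factor [(mden B x)^-1] cancels. A pole of the product is allowed: both sides are then
    0, since division by zero gives 0. *)
Lemma moebius_mulmx A B x : mden B x != 0 ->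
  moebius A (moebius B x) = moebius (A *m B) x.
Proof.
move=> B0; rewrite {1}/moebius mnum_mulmx // mden_mulmx //.
by rewrite invf_div mulrA divfK.
Qed.

(* The hypothesis says that A v and B v are collinear for v = (x, 1), hence for
   every v: each v is an eigenvector of B^-1 A, which is therefore scalar. *)
Lemma mnum_mden_cross_scale A B : \det A != 0 -> \det B != 0 ->
  (forall x, mnum A x * mden B x = mnum B x * mden A x) ->
  exists2 k, k != 0 & A = k *: B.
Proof.
move=> A0 B0 AB; pose D x := mnum A x * mden B x - mnum B x * mden A x.
have D0 x : D x = 0 by rewrite /D AB subrr.
(* [D] is quadratic in [x]; its constant, leading and middle coefficients, read off from the values
   at 0, 1 and -1, vanish. *)
have c0 : A 0 1 * B 1 1 = B 0 1 * A 1 1.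
  apply/subr0_eq; rewrite -(D0 0) /D /mnum /mden; ring.
have c2 : A 0 0 * B 1 0 = B 0 0 * A 1 0.
  have two0 : (2 : F) != 0 by rewrite Num.Theory.pnatr_eq0.
  apply: (mulfI two0); apply/subr0_eq.
  transitivity (D 1 + D (-1) - 2 * D 0); first by rewrite /D /mnum /mden; ring.
  by rewrite !D0; ring.
have c1 : A 0 0 * B 1 1 = B 0 0 * A 1 1 + B 0 1 * A 1 0 - A 0 1 * B 1 0.
  apply/subr0_eq.
  transitivity (D 1 - D 0 - (A 0 0 * B 1 0 - B 0 0 * A 1 0)).
    by rewrite /D /mnum /mden; ring.
  by rewrite !D0 c2 !subrr.
(* The scalar is the upper left entry of [\adj B *m A]: [c0] and [c2] kill the off-diagonal entries,
   [c1] equates the diagonal ones. *)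
have dA : \det B *: A = (A 0 0 * B 1 1 - B 0 1 * A 1 0) *: B.
  apply: matrix2P; rewrite !mxE det2E; apply/subr0_eq.
  - transitivity (B 0 1 * (B 0 0 * A 1 0 - A 0 0 * B 1 0)); first by ring.
    by rewrite c2 subrr mulr0.
  - rewrite c1; transitivity (B 0 0 * (A 0 1 * B 1 1 - B 0 1 * A 1 1)).
      by ring.
    by rewrite c0 subrr mulr0.
  - transitivity (B 1 1 * (B 0 0 * A 1 0 - A 0 0 * B 1 0)); first by ring.
    by rewrite c2 subrr mulr0.
  - rewrite c1; transitivity (B 1 0 * (A 0 1 * B 1 1 - B 0 1 * A 1 1)).
      by ring.
    by rewrite c0 subrr mulr0.
exists ((A 0 0 * B 1 1 - B 0 1 * A 1 0) / \det B); last first.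
  by rewrite mulrC -scalerA -dA scalerK.
apply: contraNneq A0 => /(congr1 ( *%R^~ (\det B))); rewrite mul0r divfK // => k0.
move: dA; rewrite k0 scale0r => /(canRL (scalerK B0)) ->.
by rewrite scaler0 det0.
Qed.

(** Clearing denominators gives a polynomial identity off the roots of [G] and the poles;
    multiplying by a nonzero polynomial that vanishes there extends it to every [x]. *)
Lemma moebius_eq_scale A B (G : {poly F}) :
  G != 0 -> \det A != 0 -> \det B != 0 ->
  (forall x, G.[x] != 0 -> mden A x != 0 -> mden B x != 0 ->
     moebius A x = moebius B x) ->
  exists2 k, k != 0 & A = k *: B.
Proof.
move=> G0 A0 B0 AB; apply: mnum_mden_cross_scale => // x.
pose mnump (A' : 'M[F]_2) := (A' 0 0)%:P * 'X + (A' 0 1)%:P.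
have mnumpE A' y : (mnump A').[y] = mnum A' y by rewrite !hornerE.
pose P := mnump A * mdenp B - mnump B * mdenp A.
suff /(congr1 (horner^~ x)): P = 0.
  by rewrite /P hornerD hornerN !hornerM !mnumpE !horner_mdenp horner0 => /subr0_eq.
have H0 : G * mdenp A * mdenp B != 0 by rewrite !mulf_neq0 ?mdenp_neq0.
apply: (mulfI H0); rewrite mulr0; apply: poly_eq0_eval => y.
rewrite hornerM; apply/eqP; rewrite mulf_eq0 !hornerM !horner_mdenp.
rewrite -implyNb; apply/implyP; rewrite !mulf_eq0 !negb_or => /andP[/andP[Gy Ay] By].
rewrite hornerD hornerN !hornerM !mnumpE !horner_mdenp subr_eq0.
by rewrite -eqr_div //; apply/eqP; apply: AB.
Qed.

End Moebius.

Section Transfer.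
Variables (F : numFieldType) (Q : F -> F -> {mpoly F[4]}).

Lemma degree_one_msupp : degree_one_in_each Q -> forall al be i m,
  m \in msupp (Q al be) -> (m i <= 1)%N.
Proof.
move=> degQ al be i m mQ.
by have := @leq_bigmax_seq _ _ xpredT (fun m' : 'X_{1.. 4} => m' i) m mQ isT; rewrite degQ.
Qed.

Lemma degree_one_Qval_y : degree_one_in_each Q -> forall x u y v al be,
  Qval Q x u y v al be =
  Qval Q x u 0 v al be + y * (Qval Q x u 1 v al be - Qval Q x u 0 v al be).
Proof.
move=> degQ x u y v al be.
apply: (@meval_affine _ _ _ 2%R (fun y => tnth [tuple x; u; y; v])).
  by move=> m; apply: degree_one_msupp.
by move=> z [[|[|[|[|]]]]].
Qed.

Lemma degree_one_Qval_v : degree_one_in_each Q -> forall x u y v al be,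
  Qval Q x u y v al be =
  Qval Q x u y 0 al be + v * (Qval Q x u y 1 al be - Qval Q x u y 0 al be).
Proof.
move=> degQ x u y v al be.
apply: (@meval_affine _ _ _ 3%R (fun v => tnth [tuple x; u; y; v])).
  by move=> m; apply: degree_one_msupp.
by move=> z [[|[|[|[|]]]]].
Qed.

(** A polynomial affine in [y] and in [v] is determined by its values at 0 and 1. The second row
    holds the coefficients of [y * v] and [y], the first row minus those of [v] and 1. *)
Definition transfer_mx (f1 f al la : F) : 'M[F]_2 :=
  let q y v := Qval Q f f1 y v al la in
  \matrix_(i, j)
    if i == 0 then (if j == 0 then q 0 0 - q 0 1 else - q 0 0)
    else (if j == 0 then q 1 1 - q 1 0 - q 0 1 + q 0 0 else q 1 0 - q 0 0).

Lemma transfer_transfer_mx : degree_one_in_each Q -> transfer Q transfer_mx.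
Proof.
move=> degQ f f1 al la f3 f13; rewrite !mxE /=.
rewrite degree_one_Qval_y // !(degree_one_Qval_v degQ _ _ _ f3); ring.
Qed.

(** As a function of [y], [Q] is affine with slope [mden], so off the pole it has exactly one
    root. *)
Lemma transfer_defines M : transfer Q M -> forall f f1 al la x,
  mden (M f1 f al la) x != 0 ->
  defines Q f f1 x al la (moebius (M f1 f al la) x).
Proof.
move=> MQ f f1 al la x den0.
have QE y : Qval Q f f1 y x al la = mden (M f1 f al la) x * y - mnum (M f1 f al la) x.
  by rewrite MQ.
split=> [|y]; rewrite QE; first by rewrite /moebius mulrC divfK // subrr.
by move/subr0_eq; rewrite /moebius => <-; rewrite mulrC mulKf.
Qed.

Lemma transfer_zero_curvature M : transfer Q M -> consistent3D Q ->
  forall f f1 f2 f12 al1 al2 la, defines Q f f1 f2 al1 al2 f12 ->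
  \det (M f1 f al1 la) != 0 -> \det (M f12 f1 al2 la) != 0 ->
  \det (M f2 f al2 la) != 0 -> \det (M f12 f2 al1 la) != 0 ->
  exists2 k : F, k != 0 &
    M f12 f1 al2 la *m M f1 f al1 la = k *: (M f12 f2 al1 la *m M f2 f al2 la).
Proof.
move=> MQ consQ f f1 f2 f12 al1 al2 la def12 d1 d12 d2 d21.
(* The excluded polynomial vanishes at the poles of the two inner maps, where [f13] or [f23] would
   be undefined. *)
apply: (@moebius_eq_scale _ _ _ (mdenp (M f1 f al1 la) * mdenp (M f2 f al2 la))).
- by rewrite mulf_neq0 ?mdenp_neq0.
- by rewrite det_mulmx mulf_neq0.
- by rewrite det_mulmx mulf_neq0.
move=> x; rewrite hornerM !horner_mdenp mulf_eq0 negb_or => /andP[x1 x2] x12 x21.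
rewrite -!moebius_mulmx //.
(* With [x] as [f3] and [la] as the third parameter, both compositions compute [f123], on the cube
   faces that meet along the edge from [f12] to [f123]. *)
have [+ _ _] := consQ _ _ _ _ _ _ _ _ _ _ def12
  (transfer_defines MQ x1) (transfer_defines MQ x2).
by apply; apply: transfer_defines => //; rewrite mden_mulmx // mulf_neq0 ?invr_eq0.
Qed.

End Transfer.

Theorem theorem4p3 (R : realType) (D : quadGraph) (al : D -> D -> R[i])
    (Q : R[i] -> R[i] -> {mpoly R[i][4]}) :
  labelling al ->
  degree_one_in_each Q -> D4_symmetric Q -> uniquely_solvable Q ->
  consistent3D Q ->
  (exists L : R[i] -> R[i] -> R[i] -> 'M[{poly R[i]}]_2,
    forall f : D -> R[i], solution Q al f ->
      (forall a b : D, edge a b -> \det (L (f b) (f a) (al a b)) != 0) /\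
      (forall a b c d : D, face a b c d ->
         L (f c) (f b) (al a d) *m L (f b) (f a) (al a b) =
         L (f c) (f d) (al a b) *m L (f d) (f a) (al a d))) /\
  (exists2 M : R[i] -> R[i] -> R[i] -> R[i] -> 'M[R[i]]_2, transfer Q M &
    forall f : D -> R[i], solution Q al f ->
    forall (a b c d : D) (la : R[i]), face a b c d ->
      defines Q (f a) (f b) (f d) (al a b) (al a d) (f c) ->
      \det (M (f b) (f a) (al a b) la) != 0 ->
      \det (M (f c) (f b) (al a d) la) != 0 ->
      \det (M (f d) (f a) (al a d) la) != 0 ->
      \det (M (f c) (f d) (al a b) la) != 0 ->
      exists2 k : R[i], k != 0 &
        M (f c) (f b) (al a d) la *m M (f b) (f a) (al a b) la =
        k *: (M (f c) (f d) (al a b) la *m M (f d) (f a) (al a d) la)).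
Proof.
move=> _ degQ _ _ consQ; split.
  (* Nothing ties L to M here, so the identity will do; the second part carries
     the content. *)
  exists (fun _ _ _ => 1%:M) => f _; split=> // a b _.
  by rewrite det1 oner_eq0.
exists (transfer_mx Q); first exact: transfer_transfer_mx.
move=> f _ a b c d la _; apply: transfer_zero_curvature => //.
exact: transfer_transfer_mx.
Qed.
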